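(* Let $A\in\mathbb{C}$ and let $$S(z)=\frac{z^3\left((A-1)z+2A-1\right)}{(2A-1)z+A-1}.$$ The strange fixed point $z=1$ of $S$ satisfies the following statements: 1. If $\left|A-\frac{42}{55}\right|<\frac{2}{55}$, then $z=1$ is an attractor and, in particular, it is a superattractor for $A=\frac34$. 2. If $\left|A-\frac{42}{55}\right|=\frac{2}{55}$, then $z=1$ is a parabolic fixed point. 3. If $A\neq\frac23$ and $\left|A-\frac{42}{55}\right|>\frac{2}{55}$, then $z=1$ is a repulsive fixed point.
   Context: $S$ is regarded as a rational map of the Riemann sphere $\widehat{\mathbb{C}}$, depending on the complex parameter $A$ (common factors of numerator and denominator, when present, are cancelled). A point $z_0$ is a fixed point of a rational map $R$ if $R(z_0)=z_0$. A fixed point $z_0$ is called an attractor if $|R'(z_0)|<1$, repulsive if $|R'(z_0)|>1$, parabolic (or neutral) if $|R'(z_0)|=1$, and a superattractor if $|R'(z_0)|=0$. $S$ is the map conjugate, via $M(z)=\frac{z-a}{z-b}$, to a root-finding iteration applied to $(z-a)(z-b)$, $a\ne b$, so that the roots $a,b$ correspond to the fixed points $0$ and $\infty$ of $S$; ''strange fixed point'' means a fixed point not associated with the roots, i.e. a fixed point of $S$ different from $0$ and $\infty$. *)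

(* Defs.v *)
From HB Require Import structures.
From mathcomp Require Import all_boot all_order all_algebra complex.
From mathcomp Require Import all_classical all_reals all_analysis.

Set Implicit Arguments.
Unset Strict Implicit.
Unset Printing Implicit Defensive.

Import Order.TTheory GRing.Theory Num.Theory.
Import numFieldNormedType.Exports.

Local Open Scope ring_scope.

(* The definitions are stated over an arbitrary [C : numFieldType], whose
   topology is the one given by its norm; the theorem uses them for
   [C := R[i]] with [R : realType].  [Some z] is the finite point [z], and
   [None] is the point at infinity. *)
Definition sphere (C : numFieldType) : Type := one_point_compactification C.

Definition finpt (C : numFieldType) (z : C) : sphere C := Some z.

Definition infpt (C : numFieldType) : sphere C := None.

(* The junk value [0] at infinity never matters for the derivatives below,
   because the maps considered there take finite values near the point. *)
Definition finite_part (C : numFieldType) (z : sphere C) : C :=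
  if z is Some x then x else 0.

(* The map z |-> 1 / z of the sphere. *)
Definition sphere_inv (C : numFieldType) (z : sphere C) : sphere C :=
  if z is Some x then (if x == 0 then infpt C else finpt x^-1)
  else finpt 0.

(* The self-map of the sphere given by p / q.  Common factors are cancelled
   first; the value at infinity is the limit of the reduced quotient, that is,
   the quotient of the coefficients of degree deg q' when deg p' <= deg q'. *)
Definition ratmap (C : numFieldType) (p q : {poly C}) (z : sphere C) :
    sphere C :=
  let p' := p %/ gcdp p q in
  let q' := q %/ gcdp p q in
  if z is Some x then
    (if q'.[x] == 0 then infpt C else finpt (p'.[x] / q'.[x]))
  else
    (if (size q' < size p')%N then infpt C
     else finpt (p'`_(size q').-1 / lead_coef q')).

Definition fixed_point (C : numFieldType) (f : sphere C -> sphere C)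
    (z : sphere C) : Prop := f z = z.

(* The derivative of f at a fixed point.  At infinity it is computed in the
   coordinate w = 1 / z. *)
Definition sphere_deriv (C : numFieldType) (f : sphere C -> sphere C)
    (z : sphere C) : C :=
  if z is Some x then
    derive1 (fun w : C => finite_part (f (finpt w)) : C^o) x
  else
    derive1 (fun w : C =>
      finite_part (sphere_inv (f (sphere_inv (finpt w)))) : C^o) 0.

Definition attractor (C : numFieldType) (f : sphere C -> sphere C)
    (z : sphere C) : Prop :=
  fixed_point f z /\ `|sphere_deriv f z| < 1.

Definition superattractor (C : numFieldType) (f : sphere C -> sphere C)
    (z : sphere C) : Prop :=
  fixed_point f z /\ `|sphere_deriv f z| = 0.

Definition parabolic (C : numFieldType) (f : sphere C -> sphere C)
    (z : sphere C) : Prop :=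
  fixed_point f z /\ `|sphere_deriv f z| = 1.

Definition repulsive (C : numFieldType) (f : sphere C -> sphere C)
    (z : sphere C) : Prop :=
  fixed_point f z /\ 1 < `|sphere_deriv f z|.

(* The roots a and b correspond to 0 and infinity. *)
Definition strange_fixed_point (C : numFieldType) (f : sphere C -> sphere C)
    (z : sphere C) : Prop :=
  [/\ fixed_point f z, z <> finpt 0 & z <> infpt C].

Definition S_num (C : numFieldType) (A : C) : {poly C} :=
  'X^3 * ((A - 1)%:P * 'X + (2 * A - 1)%:P).

Definition S_den (C : numFieldType) (A : C) : {poly C} :=
  (2 * A - 1)%:P * 'X + (A - 1)%:P.

Definition S_map (C : numFieldType) (A : C) : sphere C -> sphere C :=
  ratmap (S_num A) (S_den A).

(* Main.v *)
Require Import Defs.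
From mathcomp Require Import all_boot all_order all_algebra complex.
From mathcomp Require Import all_classical all_reals all_analysis.
From mathcomp Require Import ring.
Import Order.TTheory GRing.Theory Num.Theory.
Import numFieldNormedType.Exports.
Local Open Scope ring_scope.
Local Open Scope complex_scope.

(** Away from A = 2/3 the numerator and the denominator of S both take the
    nonzero value 3A - 2 at z = 1.  Hence 1 is fixed, cancelling common factors
    changes nothing near 1, and the quotient rule ([sphere_deriv_ratmap]) gives
    the multiplier S'(1) = (8A - 6) / (3A - 2) ([S_multiplier1]), which
    vanishes at A = 3/4.

    Whether this multiplier lies inside, on or outside the unit circle depends
    on the sign of |8A - 6|^2 - |3A - 2|^2.  The locus where two affine
    functions of A are in a fixed ratio of moduli, other than 1, is a circle of
    Apollonius; completing the square ([multiplier_circle]) shows that here it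
    is the circle of center 42/55 and radius 2/55, with the difference above
    being 55 (|A - 42/55|^2 - (2/55)^2).  The degenerate value 2/3 is at
    distance 16/165 > 2/55 from the center, so it never occurs in the closed
    disk. *)

Lemma is_derive_horner (C : numFieldType) (p : {poly C}) (x : C) :
  is_derive x (1 : C) (horner p : C -> C^o) p^`().[x].
Proof.
elim/poly_ind: p => [|p c IHp].
  have -> : horner (0 : {poly C}) = cst 0.
    by apply/funext => y; rewrite horner0.
  by rewrite deriv0 horner0; exact: is_derive_cst.
have -> : horner (p * 'X + c%:P) = (horner p : C -> C^o) * id + cst c.
  by apply/funext => y; rewrite !hornerE.
apply: is_derive_eq.
rewrite derivD derivC derivM derivX !hornerE /= /GRing.scale /=.
by ring.
Qed.

Lemma is_derive_ratio (C : numFieldType) (p q : {poly C}) (x : C) :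
  q.[x] != 0 ->
  is_derive x (1 : C) ((fun w => p.[w] / q.[w]) : C -> C^o)
    ((p^`().[x] * q.[x] - p.[x] * q^`().[x]) / q.[x] ^+ 2).
Proof.
move=> qx.
have [dp ep] := is_derive_horner C p x.
have [dq eq] := is_derive_horner C q x.
have dqV := @derivableV C C (horner q) x 1 qx dq.
have -> : (fun w => p.[w] / q.[w]) =
  (horner p : C -> C^o) * ((fun w => q.[w]^-1) : C -> C^o) by [].
apply: DeriveDef; first exact: derivableM.
rewrite deriveM // deriveV // ep eq /GRing.scale /=.
by field.
Qed.

(** Makes the formula for a reduced quotient valid on a neighborhood of a point,
    which is what a derivative at that point sees. *)
Lemma near_horner_neq0 (C : numFieldType) (q : {poly C}) (x : C) :
  q.[x] != 0 -> \forall w \near x, q.[w] != 0.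
Proof.
have [dq _] := is_derive_horner C q x.
have /differentiable_continuous cq : differentiable (horner q : C -> C^o) x.
  exact/derivable1_diffP.
exact: (cvgr_neq0 _ cq).
Qed.

(** A common factor of p and q cannot vanish where q does not, so cancelling it
    leaves the value unchanged; this avoids computing the gcd. *)
Lemma ratmap_finpt (C : numFieldType) (p q : {poly C}) (x : C) :
  q.[x] != 0 -> ratmap p q (finpt x) = finpt (p.[x] / q.[x]).
Proof.
move=> qx; rewrite /ratmap /=.
have qE := congr1 (horner^~ x) (divpK (dvdp_gcdr p q)).
have pE := congr1 (horner^~ x) (divpK (dvdp_gcdl p q)).
rewrite /= !hornerM in pE qE.
have : (q %/ gcdp p q).[x] * (gcdp p q).[x] != 0 by rewrite qE.
rewrite mulf_eq0 negb_or => /andP[q'x gx].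
by rewrite (negbTE q'x) -pE -qE -mulf_div divff // mulr1.
Qed.

Lemma sphere_deriv_ratmap (C : numFieldType) (p q : {poly C}) (x : C) :
  q.[x] != 0 ->
  sphere_deriv (ratmap p q) (finpt x) =
    (p^`().[x] * q.[x] - p.[x] * q^`().[x]) / q.[x] ^+ 2.
Proof.
move=> qx; have [_ <-] := is_derive_ratio C p q x qx.
rewrite [LHS]derive1E; apply: near_eq_derive.
apply: filterS (near_horner_neq0 C q x qx) => w qw.
by rewrite ratmap_finpt.
Qed.

Lemma S_fixed1 (C : numFieldType) (A : C) :
  3 * A - 2 != 0 -> fixed_point (S_map A) (finpt 1).
Proof.
move=> dA; have nE : (S_num A).[1] = 3 * A - 2.
  by rewrite /S_num !(hornerM, hornerD, hornerC, hornerX, hornerXn); ring.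
have dE : (S_den A).[1] = 3 * A - 2 by rewrite /S_den !(hornerM, hornerD, hornerC, hornerX); ring.
by rewrite /fixed_point /S_map ratmap_finpt dE // nE divff.
Qed.

Lemma S_multiplier1 (C : numFieldType) (A : C) :
  3 * A - 2 != 0 ->
  sphere_deriv (S_map A) (finpt 1) = (8 * A - 6) / (3 * A - 2).
Proof.
move=> dA; have dE : (S_den A).[1] = 3 * A - 2.
  by rewrite /S_den !(hornerM, hornerD, hornerC, hornerX); ring.
rewrite /S_map sphere_deriv_ratmap dE // /S_num /S_den.
rewrite !(derivM, derivD, derivC, derivX, derivXn).
rewrite !(hornerM, hornerD, hornerC, hornerX, hornerXn, hornerMn) /=.
by field.
Qed.

(** Substituting |z|^2 = z * conj z turns both sides into polynomials in A and
    conj A, with the same coefficients: 55 = 8^2 - 3^2 for A * conj A,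
    - 42 = - 8 * 6 + 3 * 2 for A and conj A, and 32 = 6^2 - 2^2. *)
Lemma multiplier_circle (C : numClosedFieldType) (A : C) :
  `|8 * A - 6| ^+ 2 - `|3 * A - 2| ^+ 2
    = 55 * (`|A - 42 / 55| ^+ 2 - (2 / 55) ^+ 2).
Proof.
rewrite !normCK !rmorphB !rmorphM !fmorphV !rmorph_nat.
by field.
Qed.

Theorem theorem2p3 (R : realType) (A : R[i]) :
  [/\ A <> 2 / 3 -> strange_fixed_point (S_map A) (finpt 1),
      `|A - 42 / 55| < 2 / 55 ->
        attractor (S_map A) (finpt 1) /\
        (A = 3 / 4 -> superattractor (S_map A) (finpt 1)),
      `|A - 42 / 55| = 2 / 55 -> parabolic (S_map A) (finpt 1)
    & A <> 2 / 3 -> 2 / 55 < `|A - 42 / 55| -> repulsive (S_map A) (finpt 1)].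
Proof.
have nz n : (n.+1%:R : R[i]) != 0 by rewrite pnatr_eq0.
have pole_free : A <> 2 / 3 -> 3 * A - 2 != 0.
  move=> A23; apply/eqP => /eqP; rewrite subr_eq0 => /eqP e; apply: A23.
  by rewrite -e mulrAC divff ?mul1r.
have mult_norm : 3 * A - 2 != 0 ->
    `|sphere_deriv (S_map A) (finpt 1)| = `|8 * A - 6| / `|3 * A - 2|.
  by move=> dA; rewrite S_multiplier1 // normf_div.
have r0 : 0 <= 2 / 55 :> R[i] by rewrite divr_ge0 ?ler0n.
have circle := multiplier_circle _ A.
have sq_cmp (s t : R[i]) : 0 <= s -> 0 <= t -> (s < t) = (s ^+ 2 - t ^+ 2 < 0).
  by move=> s0 t0; rewrite subr_lt0 ltr_pXn2r.
have lt_norm : (`|8 * A - 6| < `|3 * A - 2|) = (`|A - 42 / 55| < 2 / 55).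
  by rewrite sq_cmp // circle pmulr_rlt0 ?ltr0n // -sq_cmp.
have gt_norm : (`|3 * A - 2| < `|8 * A - 6|) = (2 / 55 < `|A - 42 / 55|).
  rewrite sq_cmp // -opprB circle -mulrN opprB.
  by rewrite pmulr_rlt0 ?ltr0n // -sq_cmp.
have near_circle : `|A - 42 / 55| <= 2 / 55 -> 3 * A - 2 != 0.
  move=> leA; apply: pole_free => A23; move: leA.
  (* At A = 2/3 the distance to the center exceeds the radius. *)
  have -> : A - 42 / 55 = - (16 / 165) by rewrite A23; field; rewrite ?nz.
  rewrite normrN ger0_norm ?divr_ge0 ?ler0n //.
  rewrite ler_pdivrMr ?ltr0n // mulrAC ler_pdivlMr ?ltr0n //.
  by rewrite -!natrM ler_nat.
have ngt0 (z : R[i]) : z != 0 -> 0 < `|z| by rewrite normr_gt0.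
split.
- by move=> /pole_free dA; split=> //; [exact: S_fixed1 | case=> /eqP; rewrite oner_eq0].
- move=> ltA; have dA := near_circle (ltW ltA); have fixA := S_fixed1 _ _ dA.
  split; first by split; rewrite // mult_norm // ltr_pdivrMr ?ngt0 // mul1r lt_norm.
  move=> A34; split=> //; rewrite mult_norm //.
  have -> : 8 * A - 6 = 0 by rewrite A34; field; rewrite ?nz.
  by rewrite normr0 mul0r.
- move=> eqA; have dA : 3 * A - 2 != 0 by apply: near_circle; rewrite eqA.
  split; first exact: S_fixed1.
  rewrite mult_norm //; have : `|8 * A - 6| ^+ 2 = `|3 * A - 2| ^+ 2.
    by apply/eqP; rewrite -subr_eq0 circle eqA subrr mulr0.
  by move/eqP; rewrite eqrXn2 // => /eqP ->; rewrite divff ?normr_eq0.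
- move=> /pole_free dA gtA; split; first exact: S_fixed1.
  by rewrite mult_norm // ltr_pdivlMr ?ngt0 // mul1r gt_norm.
Qed.
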